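(* Consider a TASEP satisfying the determinantal transition assumption (DET) stated in the context, let $\mathcal{M}(w)$ be the generating function of the rightmost particle's jumps defined in the context, and put $$\gamma(w)=\frac{\mathcal{M}\left(\frac12(1-w)\right)}{\mathcal{M}\left(\frac12\right)}.$$ Then $$0\le\gamma^{(2)}(0)-\{\gamma'(0)\}^2-\gamma'(0)<\infty$$ and $$\left|\gamma^{(3)}(0)-3\gamma^{(2)}(0)\gamma'(0)+2\{\gamma'(0)\}^3-2\gamma'(0)\right|<\infty,$$ where $\gamma^{(n)}$ is the $n$-th derivative of $\gamma$.
   Context: TASEP: a system of particles on $\mathbb{Z}$ with positions $\cdots<X_t(3)<X_t(2)<X_t(1)$ (order is preserved; the rightmost particle is labelled $1$), in discrete time $t\in\mathbb{Z}_{\ge0}$ or continuous time $t\in\mathbb{R}_{\ge0}$. Each particle independently and stochastically jumps to the right, only if the target site is empty (exclusion rule). Jump rates / probabilities are homogeneous and do not depend on time. Put $\Omega_N=\{\vec{x}=(x_N,\dots,x_1)\in\mathbb{Z}^N: x_N<\cdots<x_2<x_1\}$. Assumption (DET): for each $N$ the transition probability of the locations $X_t=(X_t(1),\dots,X_t(N))$ from $\vec y\in\Omega_N$ to $\vec x\in\Omega_N$ is $$\mathbb{P}(X_t=\vec x\mid X_0=\vec y)=\det[F_{i-j}(x_{N+1-i}-y_{N+1-j},t)]_{1\le i,j\le N},\qquad F_n(x,t)=\frac{(-1)^n}{2\pi i}\oint_{\Gamma_{0,1}}dw\,\frac{(1-w)^{-n}}{w^{x-n+1}}\mathcal{M}(t,w),$$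 where $\mathcal{M}(t,w)$ is analytic on $\{w\in\mathbb{C}:|w|<R\}$ with $R\ge1$, and $\Gamma_{0,1}$ is any simple loop oriented anticlockwise which includes $w=0$ and $w=1$ (understood to lie in the region of analyticity of $\mathcal{M}(t,\cdot)$). Rightmost particle: it is not affected by exclusion, so, started from $0$, it is a one-sided random walk or compound Poisson process. If $t\in\mathbb{Z}_{\ge0}$, $X_t(1)=Y_1+\cdots+Y_t$ with $Y_i$ i.i.d. non-negative integer-valued. If $t\in\mathbb{R}_{\ge0}$, $X_t(1)=Z_1+\cdots+Z_{N_t}$ with $Z_i$ i.i.d. non-negative integer-valued and $N_t$ an independent Poisson process with parameter $\lambda\in(0,\infty)$. With $G_Z(w)=\sum_{k\ge0}w^k\mathbb{P}(Z=k)$, define $\mathcal{M}(w)=G_{Y_1}(w)$ if $t\in\mathbb{Z}_{\ge0}$, and $\mathcal{M}(w)=G_X(G_{Z_1}(w))=e^{\lambda(G_{Z_1}(w)-1)}$ if $t\in\mathbb{R}_{\ge0}$, where $X$ is a Poisson random variable with parameter $\lambda$. *)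

(* Defs.v *)
From HB Require Import structures.
From mathcomp Require Import all_boot all_order all_algebra.
From mathcomp Require Import complex.
From mathcomp Require Import all_classical all_reals all_analysis.

Set Implicit Arguments.
Unset Strict Implicit.
Unset Printing Implicit Defensive.

Import Order.TTheory GRing.Theory Num.Theory.
Import numFieldNormedType.Exports.

Local Open Scope classical_set_scope.
Local Open Scope ring_scope.

(** * Generating functions and the function gamma *)

(* The time axis is discrete or continuous.  [DiscreteTime mu]: the rightmost
   particle moves by i.i.d. steps of law [mu] at integer times.
   [ContinuousTime lam mu]: it moves by i.i.d. steps of law [mu] at the points
   of a Poisson process of parameter [lam]. *)
Inductive clock (R : realType) :=
| DiscreteTime of probability nat R
| ContinuousTime of R & probability nat R.

Definition time (R : realType) (c : clock R) : set R :=
  match c with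
  | DiscreteTime _ => range (fun n : nat => n%:R)
  | ContinuousTime _ _ => [set t | 0 <= t]
  end.

Definition gen_fun (R : realType) (mu : probability nat R) (w : R) : R :=
  limn (series (fun k : nat => w ^+ k * fine (mu [set k]))).

Definition jump_gen_fun (R : realType) (c : clock R) (w : R) : R :=
  match c with
  | DiscreteTime mu => gen_fun mu w
  | ContinuousTime lam mu => expR (lam * (gen_fun mu w - 1))
  end.

Definition gamma_of (R : realType) (M : R -> R) (w : R) : R :=
  M (2^-1 * (1 - w)) / M 2^-1.

(* [f] is [n] times differentiable at [x]; the derivatives of order [< n] must
   exist around [x], since [f^`(k)] is a total function. *)
Definition n_derivable (R : realType) (n : nat) (f : R -> R) (x : R) :=
  forall k, (k < n)%N -> \forall z \near x, derivable (f^`(k))%classic z 1.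

(** * Independence and the driving random walks *)

Definition mutually_independent (R : realType) (d : measure_display)
    (T : measurableType d) (P : probability T R) (I : eqType)
    (V : I -> T -> nat) :=
  (forall i, measurable_fun setT (V i)) /\
  forall (J : seq I) (B : I -> set nat), uniq J ->
    P [set w | forall i, i \in J -> B i (V i w)] =
    (\prod_(i <- J) P (V i @^-1` B i))%E.

Definition has_law (R : realType) (d : measure_display)
    (T : measurableType d) (P : probability T R) (V : T -> nat)
    (mu : set nat -> \bar R) :=
  forall B : set nat, P (V @^-1` B) = mu B.

Definition counting_path (R : realType) (n : R -> nat) :=
  [/\ n 0 = 0%N,
      forall s t, 0 <= s -> s <= t -> (n s <= n t)%N &
      forall t, 0 <= t -> exists2 e, 0 < e &
        forall s, t <= s -> s < t + e -> n s = n t].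

(* [Y k i] is the [i]-th attempted jump of particle [k]. *)
Definition discrete_walks (R : realType) (d : measure_display)
    (T : measurableType d) (P : probability T R) (mu : probability nat R)
    (Y : nat -> nat -> T -> nat) :=
  mutually_independent P (fun j : nat * nat => Y j.1 j.2) /\
  forall k i, has_law P (Y k i) mu.

(* [N k] is the Poisson process of the attempt times of particle [k] and
   [Z k i] its [i]-th attempted jump.  Independence is stated for the increments
   of the [N k] along an arbitrary time grid [u], jointly with all the [Z k i].
   [poisson_prob r 0] is the Poisson law of parameter [r] (its second argument is
   a dummy). *)
Definition compound_poisson_walks (R : realType) (d : measure_display)
    (T : measurableType d) (P : probability T R)
    (lam : R) (mu : probability nat R)
    (N : nat -> R -> T -> nat) (Z : nat -> nat -> T -> nat) :=
  [/\ 0 < lam,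
      {ae P, forall w, forall k, counting_path (fun t => N k t w)},
      forall k s t, 0 <= s -> s <= t ->
        has_law P (fun w => N k t w - N k s w)%N
                  (poisson_prob (lam * (t - s)) 0),
      forall k i, has_law P (Z k i) mu &
      forall u : nat -> R, u 0%N = 0 -> {homo u : m n / (m <= n)%N >-> m <= n} ->
        mutually_independent P (fun j : nat * (nat + nat) =>
          match j.2 with
          | inl i => fun w => (N j.1 (u i.+1) w - N j.1 (u i) w)%N
          | inr i => Z j.1 i
          end)].

(* [S t k] is the displacement up to time [t] of particle [k] in the absence of
   exclusion.  Its law does not depend on the initial configuration [y]. *)
Definition free_walks (R : realType) (d : measure_display)
    (T : measurableType d) (Y0 : set (nat -> int))
    (P : (nat -> int) -> probability T R) (c : clock R)
    (S : R -> nat -> T -> nat) :=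
  match c with
  | DiscreteTime mu =>
      exists Y : nat -> nat -> T -> nat,
        (forall y, Y0 y -> discrete_walks (P y) mu Y) /\
        forall n k w, S n%:R k w = (\sum_(i < n) Y k i w)%N
  | ContinuousTime lam mu =>
      exists (N : nat -> R -> T -> nat) (Z : nat -> nat -> T -> nat),
        (forall y, Y0 y -> compound_poisson_walks (P y) lam mu N Z) /\
        forall t k w, 0 <= t -> S t k w = (\sum_(i < N k t w) Z k i w)%N
  end.

(** * TASEP *)

(* Particles are numbered from 0: [y k] is the position of the particle whose
   label is [k + 1].  The elements of Omega_N are the restrictions to
   [0, ..., N - 1] of the configurations. *)
Definition config : set (nat -> int) := [set y | forall k, y k.+1 < y k].

Definition same_front (N : nat) (x y : nat -> int) :=
  forall k, (k < N)%N -> x k = y k.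

(* Exclusion and motion to the right: attempted jumps can only be (partially)
   suppressed, the order is preserved, and attempts are executed in full as long
   as they stay behind the particle in front; particle 0 is never blocked.
   This covers sequential and parallel updates, and blocked jumps that are
   either cancelled or truncated. *)
Definition exclusion_path (R : realType) (tm : set R)
    (x : R -> nat -> int) (s : R -> nat -> nat) :=
  (forall t, tm t -> config (x t)) /\
  forall t t', tm t -> tm t' -> t <= t' ->
    [/\ forall k, x t k <= x t' k,
        forall k, x t' k - x t k <= (s t' k)%:Z - (s t k)%:Z,
        x t' 0%N - x t 0%N = (s t' 0%N)%:Z - (s t 0%N)%:Z &
        forall k, x t k.+1 + ((s t' k.+1)%:Z - (s t k.+1)%:Z) < x t k ->
          x t' k.+1 - x t k.+1 = (s t' k.+1)%:Z - (s t k.+1)%:Z].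

(* Time-homogeneous Markov property of the first [N] particles. *)
Definition front_markov (R : realType) (d : measure_display)
    (T : measurableType d) (tm : set R)
    (P : (nat -> int) -> probability T R) (X : R -> nat -> T -> int) :=
  forall (N m : nat) (u : nat -> R) (t : R) (y x : nat -> int)
      (z : nat -> nat -> int),
    config y -> config x -> config (z m) -> tm t -> (forall i, tm (u i)) ->
    {homo u : i j / (i <= j)%N >-> i <= j} ->
    let past := [set w | forall i, (i <= m)%N ->
                   same_front N (fun k => X (u i) k w) (z i)] in
    P y (past `&` [set w | same_front N (fun k => X (u m + t) k w) x]) =
    (P y past * P (z m) [set w | same_front N (fun k => X t k w) x])%E.

(* [P y] is the law of the system started from the configuration [y]. *)
Definition is_tasep (R : realType) (d : measure_display)
    (T : measurableType d) (c : clock R)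
    (P : (nat -> int) -> probability T R) (X : R -> nat -> T -> int) :=
  [/\ forall t k v, time c t -> measurable (X t k @^-1` [set v]),
      forall y, config y -> {ae P y, forall w, forall k, X 0 k w = y k},
      front_markov (time c) P X &
      exists S : R -> nat -> T -> nat,
        free_walks config P c S /\
        forall y, config y -> {ae P y, forall w,
          exclusion_path (time c) (fun t k => X t k w) (fun t k => S t k w)}].

(** * Contour integrals *)

Definition C1 (R : realType) (f : R -> R) :=
  (forall s, derivable f s 1) /\ continuous (f^`())%classic.

Definition piecewise_C1 (R : realType) (f : R -> R) :=
  exists (n : nat) (u : nat -> R),
    [/\ u 0%N = 0, u n = 1 &
        forall i, (i < n)%N -> u i < u i.+1 /\
          exists2 g, C1 g & {in `[u i, u i.+1], f =1 g}].

(* The derivative is taken componentwise; at the finitely many break points of a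
   piecewise C1 path its value is irrelevant. *)
Definition path_derive (R : realType) (g : R -> R[i]) (s : R) : R[i] :=
  Complex ((fun r => complex.Re (g r))^`()%classic s)
          ((fun r => complex.Im (g r))^`()%classic s).

Definition contour_integral (R : realType) (g : R -> R[i])
    (f : R[i] -> R[i]) : R[i] :=
  let h s := f (g s) * path_derive g s in
  Complex (\int[lebesgue_measure]_(s in `[0, 1]) complex.Re (h s))
          (\int[lebesgue_measure]_(s in `[0, 1]) complex.Im (h s)).

Definition two_pi_i (R : realType) : R[i] := Complex 0 (2 * pi).

Definition winding_number (R : realType) (g : R -> R[i]) (a : R[i]) : R[i] :=
  (two_pi_i R)^-1 * contour_integral g (fun w => (w - a)^-1).

Definition simple_loop (R : realType) (g : R -> R[i]) :=
  [/\ piecewise_C1 (fun s => complex.Re (g s)),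
      piecewise_C1 (fun s => complex.Im (g s)),
      g 0 = g 1 &
      {in `[0, 1[ &, injective g}].

(* For a simple loop, winding number 1 means: [a] is inside, and the loop is
   oriented anticlockwise. *)
Definition encloses (R : realType) (g : R -> R[i]) (a : R[i]) :=
  (forall s, s \in `[0, 1] -> g s != a) /\ winding_number g a = 1.

Definition open_disk (R : realType) (rad : \bar R) : set R[i] :=
  [set w | ((ComplexField.Normc.normc w)%:E < rad)%E].

Definition analytic_on (R : realType) (D : set R[i]) (f : R[i] -> R[i]) :=
  forall w, D w -> derivable (f : R[i]^o -> R[i]^o) w 1.

(* [Gamma_{0,1}], inside the region where [Mt t] is analytic. *)
Definition loop01 (R : realType) (rad : \bar R) (g : R -> R[i]) :=
  [/\ simple_loop g, encloses g 0, encloses g 1 &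
      forall s, s \in `[0, 1] -> open_disk rad (g s)].

(** * The determinantal transition assumption *)

Definition F_fun (R : realType) (Mt : R -> R[i] -> R[i]) (g : R -> R[i])
    (n x : int) (t : R) : R[i] :=
  (-1) ^ n / two_pi_i R *
  contour_integral g
    (fun w => (1 - w) ^ (- n) / w ^ (x - n + 1) * Mt t w).

(* With 0-based labels and indices, [x_{N+1-i}] is [x (rev_ord i)]. *)
Definition DET (R : realType) (d : measure_display)
    (T : measurableType d) (tm : set R)
    (P : (nat -> int) -> probability T R) (X : R -> nat -> T -> int)
    (rad : \bar R) (Mt : R -> R[i] -> R[i]) :=
  [/\ (1 <= rad)%E,
      forall t, tm t -> analytic_on (open_disk rad) (Mt t),
      exists g, loop01 rad g &
      forall g, loop01 rad g ->
      forall (N : nat) (y x : nat -> int) (t : R),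
        config y -> config x -> tm t ->
        (fine (P y [set w | same_front N (fun k => X t k w) x]))%:C%C =
        \det (\matrix_(i < N, j < N)
               F_fun Mt g (i%:Z - j%:Z) (x (rev_ord i) - y (rev_ord j)) t)].

(* Main.v *)
Require Import Defs.
From HB Require Import structures.
From mathcomp Require Import all_boot all_order all_algebra.
From mathcomp Require Import complex ring lra.
From mathcomp Require Import all_classical all_reals all_analysis.

Set Implicit Arguments.
Unset Strict Implicit.
Unset Printing Implicit Defensive.

Import Order.TTheory GRing.Theory Num.Theory.
Import numFieldNormedType.Exports.

Local Open Scope classical_set_scope.
Local Open Scope ring_scope.

(** Let [M] be the generating function of the jumps and [m_k] its [k]-th
   derivative at [1/2].  By the chain rule the [k]-th derivative of gamma at [0]
   is [m_k / ((-2) ^ k m_0)], so that [g2 - g1 ^ 2 - g1] is the value at [w = 1/2]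
   of [(w d/dw)^2 log M].  In discrete time this is the variance of the step law
   tilted by [2 ^ (- k)]; in continuous time [log M = lam (G - 1)] and it is [lam]
   times the second moment of the tilted weights.  Derivatives of all orders
   exist because the radius of convergence is at least [1 > 1/2]. *)

(** * Iterated derivatives along a chain of functions *)

(** The equality is propagated on a neighbourhood, because differentiating once more at [x] requires
    it around [x]. *)
Lemma near_derive1n_chain (R : realType) (f : nat -> R -> R) (x : R) (n : nat) :
  (forall k, (k < n)%N -> \forall z \near x, is_derive z (1 : R) (f k) (f k.+1 z)) ->
  forall k, (k <= n)%N -> \forall z \near x, ((f 0%N)^`(k))%classic z = f k z.
Proof.
move=> df; elim=> [_|k IH kn]; first by near=> z.
move/near_join: (IH (ltnW kn)) (df _ kn) => eqk dk.
near=> z.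
rewrite derive1nS derive1E (@near_eq_derive _ _ _ _ (f k) z 1); last first.
  by near: z.
have dkz : is_derive z (1 : R) (f k) (f k.+1 z) by near: z.
exact: derive_val.
Unshelve. all: by end_near. Qed.

Lemma n_derivable_chain (R : realType) (f : nat -> R -> R) (x : R) (n : nat) :
  (forall k, (k < n)%N -> \forall z \near x, is_derive z (1 : R) (f k) (f k.+1 z)) ->
  n_derivable n (f 0%N) x.
Proof.
move=> df k kn.
move/near_join: (near_derive1n_chain df (ltnW kn)) (df _ kn) => eqk dk.
near=> z.
apply: (@near_eq_derivable _ _ _ (f k)).
  by near: z; apply: filterS eqk => y; apply: filterS => u.
have dkz : is_derive z (1 : R) (f k) (f k.+1 z) by near: z.
exact: ex_derive.
Unshelve. all: by end_near. Qed.

(** * Termwise differentiation of power series *)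

Lemma linear_le_expr (R : realDomainType) (e : R) (n : nat) :
  0 <= e -> n%:R * e <= (1 + e) ^+ n.
Proof.
move=> e0; elim: n => [|n IH]; first by rewrite mul0r expr0 ler01.
rewrite exprS -natr1 !mulrDl !mul1r lerD//.
have : 1 <= (1 + e) ^+ n by rewrite exprn_ege1// lerDl.
by move=> h; rewrite ler_peMr.
Qed.

(** A slightly larger radius absorbs the factor [n.+1]: with [|z| < s < r < |x|], the differentiated
    series at [s] is dominated by a multiple of the absolute series at [r]. *)
Lemma is_cvg_pseries_diffs (R : realType) (c : R^nat) (x z : R) :
  cvgn (pseries c x) -> `|z| < `|x| -> cvgn (pseries (pseries_diffs c) z).
Proof.
move=> cx zx.
have [s [r [zs sr rx]]] : exists s r, [/\ `|z| < s, s < r & r < `|x|].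
  by exists ((2 * `|z| + `|x|) / 3), ((`|z| + 2 * `|x|) / 3); split; lra.
have z0 := normr_ge0 z.
have s0 : 0 < s by lra.
have r0 : 0 < r by lra.
have cr : cvgn (pseries (fun i => `|c i|) r).
  by apply: is_cvg_pseries_inside_norm cx _; rewrite gtr0_norm.
apply: (@is_cvg_pseries_inside _ _ s); last by rewrite (gtr0_norm s0).
apply: normed_cvg; rewrite /normed_series_of /=.
(* [e] is the relative gap between the radii, so that [n.+1%:R * e <= (1 + e) ^+ n.+1] turns powers
   of [s] into powers of [r]. *)
have [e e0 rE] : exists2 e, 0 < e & r = s * (1 + e).
  exists (r / s - 1); first by rewrite subr_gt0 ltr_pdivlMr// mul1r.
  by rewrite addrC subrK mulrCA divff ?mulr1// gt_eqF.
have se0 : 0 < s * e by exact: mulr_gt0.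
apply: (@series_le_cvg _ _ ((s * e)^-1 *: (fun n => `|c n.+1| * r ^+ n.+1))).
- by move=> n.
- by move=> n; rewrite /GRing.scale /= !mulr_ge0// ?invr_ge0 ?mulr_ge0 ?exprn_ge0// ltW.
- move=> n; rewrite /pseries_diffs !normrM normr_nat normrX (gtr0_norm s0).
  rewrite ler_pdivlMl//.
  have -> : s * e * (n.+1%:R * `|c n.+1| * s ^+ n) =
     `|c n.+1| * (s ^+ n.+1 * (n.+1%:R * e)) by rewrite exprS; ring.
  rewrite rE exprMn ler_wpM2l// ler_wpM2l//; first by rewrite exprn_ge0// ltW.
  by apply: linear_le_expr; exact: ltW.
apply: is_cvg_seriesZ.
(* The majorant is the series at [r] deprived of its term of index 0. *)
set b := fun i => `|c i| * r ^+ i.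
have -> : series (fun n => b n.+1) = (fun n => series b n.+1 - b 0%N).
  by apply/funext => n; rewrite [series b _]big_nat_recl// addrC addKr.
apply: is_cvgB; last exact: is_cvg_cst.
by move/cvg_ex: cr => [l ?]; apply/cvg_ex; exists l; rewrite (cvg_shiftS (series b)).
Qed.

(** The Euler operator [x d/dx] multiplies the [i]-th coefficient by [i]. *)
Lemma cvg_pseries_mulrn (R : realType) (c : R^nat) (x : R) :
  cvgn (pseries (pseries_diffs c) x) ->
  pseries (fun i => i%:R * c i) x @ \oo --> x * limn (pseries (pseries_diffs c) x).
Proof.
move=> /pseries_diffs_equiv/(cvgM (cvg_cst x)).
apply: cvg_trans; rewrite (_ : pseries _ x = fun n => x * series (fun i => i%:R * c i * x ^+ i.-1) n) //.
apply/funext => n; rewrite /pseries /series /= mulr_sumr.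
(* [i.-1] truncates at [i = 0], where the factor [i%:R] vanishes. *)
by apply: eq_bigr => -[|i] _; rewrite ?mul0r ?mulr0// exprS /=; ring.
Qed.

(** * Derivatives of gamma at 0 *)

Lemma derive_affine (R : realType) (f : R -> R) (df C z : R) :
  is_derive (2^-1 * (1 - z)) 1 f df ->
  is_derive z 1 (fun w => f (2^-1 * (1 - w)) / C) (- 2^-1 * df / C).
Proof.
move=> dfz.
have dh : is_derive z 1 (fun w : R => 2^-1 * (1 - w)) (- 2^-1).
  by apply: is_derive_eq; rewrite /GRing.scale /=; ring.
have dfh := @is_derive1_comp _ f (fun w : R => 2^-1 * (1 - w)) _ _ _ dfz dh.
have -> : (fun w => f (2^-1 * (1 - w)) / C) =
    C^-1 \*: (f \o (fun w : R => 2^-1 * (1 - w))).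
  by apply/funext => w; rewrite /GRing.scale /= mulrC.
by apply: is_derive_eq; rewrite /GRing.scale /=; ring.
Qed.

Lemma gamma_of_derivatives (R : realType) (M : nat -> R -> R) (n : nat) :
  (forall k (z : R), (k < n)%N -> 0 < z < 1 -> is_derive z 1 (M k) (M k.+1 z)) ->
  n_derivable n (gamma_of (M 0%N)) 0 /\
  forall k, (k <= n)%N ->
    ((gamma_of (M 0%N))^`(k))%classic 0 =
    M k 2^-1 / (M 0%N 2^-1 * (-2) ^+ k).
Proof.
move=> dM.
(* Candidate for the [k]-th derivative near 0; [(-2) ^+ k] collects the chain-rule factors
   [- 2^-1]. *)
pose f k w := M k (2^-1 * (1 - w)) / (M 0%N 2^-1 * (-2) ^+ k).
have -> : gamma_of (M 0%N) = f 0%N.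
  by apply/funext => w; rewrite /gamma_of /f expr0 mulr1.
have df k : (k < n)%N -> \forall z \near (0 : R), is_derive z (1 : R) (f k) (f k.+1 z).
  move=> kn; near=> z.
  (* Both bounds together put [2^-1 * (1 - z)] strictly between 0 and 1, where [dM] applies. *)
  have z1 : -1 < z by near: z; apply: lt_nbhsr; rewrite ltrN10.
  have z2 : z < 1 by near: z; apply: lt_nbhsl; rewrite ltr01.
  have dMz : is_derive (2^-1 * (1 - z)) 1 (M k) (M k.+1 (2^-1 * (1 - z))).
    by apply: dM => //; apply/andP; split; lra.
  apply: (is_derive_eq (derive_affine _ dMz)).
  by rewrite /f exprS !invfM invrN; ring.
split; first exact: n_derivable_chain.
move=> k kn; have := near_derive1n_chain df kn => /nbhs_singleton ->.
by rewrite /f subr0 mulr1.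
Unshelve. all: by end_near. Qed.

(** * Generating series of a law on the naturals *)

Lemma gen_fun_pseries (R : realType) (mu : probability nat R) (w : R) :
  gen_fun mu w = limn (pseries (fun k => fine (mu [set k])) w).
Proof.
by rewrite /gen_fun /pseries; congr (limn (series _)); apply/funext => k; rewrite mulrC.
Qed.

(** Atoms weigh at most 1, so the geometric series of ratio [|w|] dominates. *)
Lemma is_cvg_pgf (R : realType) (mu : probability nat R) (w : R) : `|w| < 1 ->
  cvgn (pseries (fun k => fine (mu [set k])) w).
Proof.
move=> w1; apply: normed_cvg.
apply: (@series_le_cvg _ _ (geometric 1 `|w|)).
- by move=> n /=.
- by move=> n; rewrite /= mul1r exprn_ge0.
- move=> n; rewrite /= normrM normrX ler_wpM2r ?exprn_ge0//.
  rewrite ger0_norm ?fine_ge0// -lee_fin fineK ?fin_num_measure//.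
  exact: probability_le1.
- by apply: is_cvg_geometric_series; rewrite normr_id.
Qed.

(** If every atom were null, countable additivity would give total mass 0. *)
Lemma probability_nat_atom (R : realType) (mu : probability nat R) :
  exists k, 0 < fine (mu [set k]).
Proof.
apply: contrapT => /forallNP mu0.
have : (mu setT = 0)%E.
  have -> : setT = \bigcup_(k in setT) [set k] :> set nat.
    by rewrite bigcup_imset1 image_id.
  rewrite measure_bigcup//; last first.
    by move=> i j _ _ [k [/= -> ->]].
  rewrite eseries0// => k _ _.
  have := mu0 k; rewrite lt_neqAle fine_ge0// andbT => /negP/negPn/eqP e.
  by rewrite /= -[LHS]fineK ?fin_num_measure// -e.
by rewrite probability_setT => /eqP; rewrite onee_eq0.
Qed.

(** * Moments of the weights [c i * x ^+ i] *)

Section NonnegativePowerSeries.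
Context {R : realType} (c : R^nat).
Hypothesis cvg_c : forall x, `|x| < 1 -> cvgn (pseries c x).
(** The [k]-th derivative of the sum of the series, for [|x| < 1]. *)
Let G k x := limn (pseries (iter k (@pseries_diffs R) c) x).

Lemma is_cvg_iter_diffs k x : `|x| < 1 -> cvgn (pseries (iter k (@pseries_diffs R) c) x).
Proof.
elim: k x => [|k IH] x x1; first exact: cvg_c.
have x0 := normr_ge0 x.
(* The midpoint of [|x|] and 1 leaves room for the radius lost at each differentiation. *)
apply: (@is_cvg_pseries_diffs _ _ ((1 + `|x|) / 2)).
  by apply: IH; rewrite ger0_norm; lra.
by rewrite [ltRHS]ger0_norm; lra.
Qed.

Lemma is_derive_iter_diffs k (x : R) : `|x| < 1 -> is_derive x 1 (G k) (G k.+1 x).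
Proof.
move=> x1; have x0 := normr_ge0 x.
have y1 : `|(1 + `|x|) / 2| < 1 by rewrite ger0_norm; lra.
apply: (@pseries_snd_diffs _ _ ((1 + `|x|) / 2)).
- exact: is_cvg_iter_diffs.
- exact: (@is_cvg_iter_diffs k.+1).
- exact: (@is_cvg_iter_diffs k.+2).
- by rewrite [ltRHS]ger0_norm; lra.
Qed.

(** The Euler operator applied once and twice to [G 0] yields the unnormalised first and second
    moments. *)
Lemma cvg_moments (x : R) : `|x| < 1 ->
  pseries (fun i => i%:R * c i) x @ \oo --> x * G 1 x /\
  pseries (fun i => i%:R ^+ 2 * c i) x @ \oo --> x * (x * G 2 x + G 1 x).
Proof.
move=> x1.
have h1 : cvgn (pseries (pseries_diffs c) x) := @is_cvg_iter_diffs 1 x x1.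
have h2 : cvgn (pseries (pseries_diffs (pseries_diffs c)) x) := @is_cvg_iter_diffs 2 x x1.
split; first exact: cvg_pseries_mulrn.
have -> : (fun i => i%:R ^+ 2 * c i) = (fun i => i%:R * (i%:R * c i)).
  by apply/funext => i; rewrite expr2 mulrA.
(* Product rule for the derivative of [x * G 1 x], read on coefficients. *)
have h : pseries (pseries_diffs (fun i => i%:R * c i)) x @ \oo --> x * G 2 x + G 1 x.
  have -> : pseries (pseries_diffs (fun i => i%:R * c i)) x =
    pseries (fun i => i%:R * pseries_diffs c i) x \+ pseries (pseries_diffs c) x.
    apply/funext => n; rewrite /pseries /series /= -big_split /=.
    by apply: eq_bigr => i _; rewrite /pseries_diffs -natr1; ring.
  by apply: cvgD => //; exact: cvg_pseries_mulrn.
rewrite -(cvg_lim _ h)//; apply: cvg_pseries_mulrn; apply/cvg_ex; eexists; exact: h.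
Qed.

Hypothesis c_ge0 : forall i, 0 <= c i.

Lemma second_moment_ge0 (x : R) : 0 <= x < 1 -> 0 <= x * (x * G 2 x + G 1 x).
Proof.
move=> /andP[x0 x1]; have [|_ h2] := @cvg_moments x; first by rewrite ger0_norm.
apply: (cvgr_to_ge h2); near=> n.
by apply: sumr_ge0 => i _; rewrite !mulr_ge0 ?exprn_ge0.
Unshelve. all: by end_near. Qed.

(* The variance of the law with weights [c i * x ^+ i / G 0 x], times [G 0 x ^+ 2]. *)
Lemma variance_ge0 (x : R) : 0 <= x < 1 -> 0 < G 0 x ->
  (x * G 1 x) ^+ 2 <= G 0 x * (x * (x * G 2 x + G 1 x)).
Proof.
move=> /andP[x0 x1] G0; have nx : `|x| < 1 by rewrite ger0_norm.
have [h1 h2] := cvg_moments nx.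
have h0 : pseries c x @ \oo --> G 0 x := cvg_c nx.
move: h1 h2 h0.
set A1 := x * G 1 x; set A2 := x * _; set A0 := G 0 x => h1 h2 h0.
(* The mean of the tilted law; expanding the nonnegative sum of [(i%:R - t) ^+ 2 * (c i * x ^+ i)]
   gives the inequality. *)
pose t := A1 / A0.
have : 0 <= A2 - 2 * t * A1 + t ^+ 2 * A0.
  have h : pseries (fun i => i%:R ^+ 2 * c i) x
     - cst (2 * t) * pseries (fun i => i%:R * c i) x
     + cst (t ^+ 2) * pseries c x @ \oo --> A2 - 2 * t * A1 + t ^+ 2 * A0.
    exact: cvgD (cvgB h2 (cvgM (cvg_cst _) h1)) (cvgM (cvg_cst _) h0).
  apply: (cvgr_to_ge h); near=> n.
  rewrite /= !fctE /pseries /series /= !mulr_sumr -sumrB -big_split /=.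
  apply: sumr_ge0 => i _.
  rewrite (_ : _ + _ = (i%:R - t) ^+ 2 * (c i * x ^+ i)); last by ring.
  by rewrite mulr_ge0 ?sqr_ge0// mulr_ge0// exprn_ge0.
rewrite (_ : _ + _ = (A0 * A2 - A1 ^+ 2) / A0); last by rewrite /t; field; rewrite gt_eqF.
by rewrite pmulr_lge0 ?invr_gt0// subr_ge0.
Unshelve. all: by end_near. Qed.

End NonnegativePowerSeries.

Section ProbabilityGeneratingFunction.
Context {R : realType} (mu : probability nat R).

Definition gen_fun_deriv (k : nat) (x : R) : R :=
  limn (pseries (iter k (@pseries_diffs R) (fun i => fine (mu [set i]))) x).

Lemma gen_fun_deriv0 : gen_fun mu = gen_fun_deriv 0.
Proof. by apply/funext => w; exact: gen_fun_pseries. Qed.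

Lemma is_derive_gen_fun k (x : R) : `|x| < 1 ->
  is_derive x 1 (gen_fun_deriv k) (gen_fun_deriv k.+1 x).
Proof. by move=> ?; apply: is_derive_iter_diffs => // y; exact: is_cvg_pgf. Qed.

Lemma gen_fun_gt0 (x : R) : 0 < x < 1 -> 0 < gen_fun_deriv 0 x.
Proof.
move=> /andP[x0 x1]; have [k pk] := probability_nat_atom mu.
have cx : cvgn (pseries (fun i => fine (mu [set i])) x).
  by apply: is_cvg_pgf; rewrite gtr0_norm.
have nn i : 0 <= fine (mu [set i]) * x ^+ i.
  by rewrite mulr_ge0 ?fine_ge0// exprn_ge0// ltW.
(* The partial sum of length [k.+1] is the first to contain the atom [k]. *)
apply: lt_le_trans (nondecreasing_cvgn_le _ cx k.+1); last first.
  by apply/nondecreasing_series => i _ _; exact: nn.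
rewrite /pseries /series /= big_nat_recr//= ltr_wpDl ?mulr_gt0 ?exprn_gt0//.
by apply: sumr_ge0 => i _; exact: nn.
Qed.

End ProbabilityGeneratingFunction.

(** * From tilted moments to the bounds *)

(** Since [g1 = - m_1 / (2 m_0)] and [g2 = m_2 / (4 m_0)], the assumed inequality is
    [0 <= g2 - g1 ^+ 2 - g1]. The analytic content of finiteness is [n_derivable 3]. *)
Lemma gamma_of_bounds (R : realType) (M : nat -> R -> R) :
  (forall k (z : R), (k < 3)%N -> 0 < z < 1 -> is_derive z 1 (M k) (M k.+1 z)) ->
  M 0%N 2^-1 != 0 ->
  0 <= (M 2%N 2^-1 / M 0%N 2^-1 - (M 1%N 2^-1 / M 0%N 2^-1) ^+ 2) / 4 +
       M 1%N 2^-1 / M 0%N 2^-1 / 2 ->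
  let gamma := gamma_of (M 0%N) in
  let g1 := gamma^`(1)%classic 0 in
  let g2 := gamma^`(2)%classic 0 in
  let g3 := gamma^`(3)%classic 0 in
  [/\ n_derivable 3 gamma 0,
      (0 <= (g2 - g1 ^+ 2 - g1)%:E < +oo)%E &
      (`|(g3 - 3 * g2 * g1 + 2 * g1 ^+ 3 - 2 * g1)%:E| < +oo)%E].
Proof.
move=> dM M0 var gamma g1 g2 g3.
have [nd gE] := gamma_of_derivatives dM.
split=> //; last by rewrite ltry.
rewrite ltry andbT lee_fin /g1 /g2 /gamma !gE//.
by apply: le_trans var _; rewrite le_eqVlt; apply/orP; left; apply/eqP; field.
Qed.

Lemma continuous_rate_gt0 (R : realType) (d : measure_display)
    (T : measurableType d) (lam : R) (mu : probability nat R)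
    (P : (nat -> int) -> probability T R) (X : R -> nat -> T -> int) :
  is_tasep (ContinuousTime lam mu) P X -> 0 < lam.
Proof.
move=> [_ _ _ [S [[N [Z [walks _]]] _]]].
(* Positivity of the rate is recorded for each initial configuration, so one is exhibited: the step
   configuration. *)
have cy : config (fun k => - k%:Z) by move=> k; rewrite ltrN2 ltz_nat.
by have [] := walks _ cy.
Qed.

Theorem theorem2p15 (R : realType) (d : measure_display)
    (T : measurableType d) (c : clock R)
    (P : (nat -> int) -> probability T R) (X : R -> nat -> T -> int)
    (rad : \bar R) (Mt : R -> R[i] -> R[i]) :
  is_tasep c P X ->
  DET (time c) P X rad Mt ->
  let gamma := gamma_of (jump_gen_fun c) in
  let g1 := gamma^`(1)%classic 0 in
  let g2 := gamma^`(2)%classic 0 in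
  let g3 := gamma^`(3)%classic 0 in
  [/\ n_derivable 3 gamma 0,
      (0 <= (g2 - g1 ^+ 2 - g1)%:E < +oo)%E &
      (`|(g3 - 3 * g2 * g1 + 2 * g1 ^+ 3 - 2 * g1)%:E| < +oo)%E].
Proof.
move=> + _.
have half : 0 <= (2^-1 : R) < 1 by apply/andP; split; lra.
have half_gt0 : 0 < (2^-1 : R) < 1 by apply/andP; split; lra.
have norm1 (z : R) : 0 < z < 1 -> `|z| < 1 by move=> /andP[z0 z1]; rewrite gtr0_norm.
case: c => [mu _|lam mu /continuous_rate_gt0 lam0].
  have G0 := gen_fun_gt0 mu half_gt0.
  rewrite /jump_gen_fun (_ : (fun w => gen_fun mu w) = gen_fun_deriv mu 0); last first.
    by rewrite gen_fun_deriv0.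
  apply: gamma_of_bounds.
  - by move=> k z _ /norm1; exact: is_derive_gen_fun.
  - by rewrite gt_eqF.
  have := @variance_ge0 _ (fun i => fine (mu [set i])) (@is_cvg_pgf _ mu)
    (fun i => fine_ge0 (measure_ge0 _ _)) _ half G0.
  rewrite -/(gen_fun_deriv mu 0 _) -/(gen_fun_deriv mu 1 _) -/(gen_fun_deriv mu 2 _).
  move: G0; set a := gen_fun_deriv mu 0 _; set b := gen_fun_deriv mu 1 _.
  set e := gen_fun_deriv mu 2 _ => a0 ab.
  (* The quantity is the variance of the step law tilted by [2^-1 ^+ k]. *)
  rewrite (_ : _ + _ = (a * (2^-1 * (2^-1 * e + b)) - (2^-1 * b) ^+ 2) / a ^+ 2).
    by rewrite divr_ge0 ?sqr_ge0// subr_ge0.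
  by field; rewrite gt_eqF.
pose G := gen_fun_deriv mu.
pose E (z : R) := expR (lam * (G 0%N z - 1)).
(* Successive derivatives of [E] up to order 3; the default branch serves as the third. *)
pose M k z := match k with
  | 0 => E z
  | 1 => lam * G 1%N z * E z
  | 2 => (lam * G 2%N z + lam ^+ 2 * G 1%N z ^+ 2) * E z
  | _ => (lam * G 3%N z + 3 * lam ^+ 2 * G 1%N z * G 2%N z
          + lam ^+ 3 * G 1%N z ^+ 3) * E z
  end.
have -> : jump_gen_fun (ContinuousTime lam mu) = M 0%N.
  by apply/funext => w; rewrite /jump_gen_fun gen_fun_deriv0.
have E0 : E 2^-1 != 0 by rewrite gt_eqF ?expR_gt0.
apply: gamma_of_bounds => //.
  move=> k z k3 /norm1 z1.
  have dG j : is_derive z 1 (G j) (G j.+1 z) := is_derive_gen_fun mu j z1.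
  have d0 := dG 0%N; have d1 := dG 1%N; have d2 := dG 2%N.
  have dE : is_derive z 1 E (lam * G 1%N z * E z).
    have dl : is_derive z 1 (fun w => lam * (G 0%N w - 1)) (lam * G 1%N z).
      by apply: is_derive_eq; rewrite /GRing.scale /=; ring.
    apply: (is_derive_eq (@is_derive1_comp _ expR _ _ _ _ (is_derive_expR _) dl)).
    by rewrite mulrC.
  case: k k3 => [|[|[|//]]] _ //=; apply: is_derive_eq;
    rewrite /GRing.scale /=; ring.
have G2 : 0 <= 2^-1 * (2^-1 * G 2%N 2^-1 + G 1%N 2^-1).
  apply: (@second_moment_ge0 _ (fun i => fine (mu [set i]))) half => [x|i].
    exact: is_cvg_pgf.
  exact/fine_ge0/measure_ge0.
(* The [lam ^+ 2] part of the second derivative cancels against the squared first one, leaving an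
   expression linear in [lam]. *)
rewrite /M (_ : _ + _ = lam * (2^-1 * (2^-1 * G 2%N 2^-1 + G 1%N 2^-1))).
  by rewrite mulr_ge0// ltW.
by field.
Qed.
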